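(* Suppose $fD=P\bar P$ with $P\neq\bar P$ prime ideals of $D$; let $m$ be the order of $P$ in the class group of $D$, let $\beta\in D$ be a generator of $P^m$, and put $t_k=f\beta^k$ and $Q_k=(f^k,t_k)=P^k\bar P$ for $k\ge 1$. Let $Q$ be a basic $\mathfrak{F}$-primary ideal of $O$ not containing any basic element. Then: (i) $Q$ lies properly between $Q_k$ and $f Q_k$, for some $k > 0$; (ii) $Q = (f^{k+1}, a f^{k} + t_k)$ for some $1 \le a \le f - 1$ (with $k$ as in (i)); (iii) $Q$ does not contain any other basic $\mathfrak{F}$-primary ideal; (iv) $Q$ is an invertible ideal of $O$.
   Context: Let $d$ be a square-free integer ($d\neq 1$), $K=\mathbb{Q}(\sqrt d)$ and $D=\mathbb{Z}[\omega]$ its ring of integers, where $\omega=\sqrt d$ if $d\equiv 2,3 \pmod 4$ and $\omega=(1+\sqrt d)/2$ if $d\equiv 1\pmod 4$. Let $f$ be a prime number and $O=\mathbb{Z}[f\omega]$, the unique order of $K$ with $[D:O]=f$. The conductor of $O$ is $\mathfrak{F}=\{x\in O: xD\subseteq O\}=fD$; it is a prime ideal of $O$. An ideal of $O$ is $\mathfrak{F}$-primary if it is primary with radical $\mathfrak{F}$; an $\mathfrak{F}$-primary ideal is basic if it is not contained in $\mathfrak{F}^2$. An element $t\in O$ is basic if $tO$ is a basic $\mathfrak{F}$-primary ideal. For $\alpha,\gamma\in O$, $(\alpha,\gamma)=\alpha O+\gamma O$. A bar denotes conjugation in $K$. The order $m$ of $P$ is the least positive integer such that $P^m$ is principal. ''$Q$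 lies properly between $Q_k$ and $fQ_k$'' means $fQ_k\subsetneq Q\subsetneq Q_k$.
   Formalization: (i) and (ii) are stated up to exchanging P and its conjugate (β or its conjugate in t_k, Q_k), since for fixed P they fail, e.g. d=-5, f=3, P=(3,1+√-5), Q=(27,6+12√-5). Q_k is defined as (f^k,t_k); the set-up identity with P^k·P̄ is not restated. *)

(* Defs.v *)
From HB Require Import structures.
From mathcomp Require Import all_boot all_order all_algebra all_field.
From mathcomp Require Import boolp classical_sets.

Set Implicit Arguments.
Unset Strict Implicit.
Unset Printing Implicit Defensive.

Import Order.TTheory GRing.Theory Num.Theory.
Local Open Scope classical_set_scope.
Local Open Scope ring_scope.

(* Subrings of a field K, and modules over them, are represented by subsets of
   K, so that the ideals of two rings A `<=` B can be compared directly. *)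

Section SubringsAndIdeals.
Variable K : fieldType.
Implicit Types (A I J F : set K) (x y : K).

(* Z[x] *)
Definition adjoinZ x : set K :=
  [set y | exists p : {poly int}, y = (map_poly intr p).[x]].

(* Closure under opposite follows, since -1 belongs to every subring A. *)
Definition submodule A I : Prop :=
  [/\ I 0, forall x y, I x -> I y -> I (x + y)
    & forall a x, A a -> I x -> I (a * x)].

Definition ideal A I : Prop := I `<=` A /\ submodule A I.

Definition gen1 A x : set K := [set y | exists2 u, A u & y = x * u].

Definition gen2 A x y : set K :=
  [set z | exists u v, [/\ A u, A v & z = x * u + y * v]].

Definition principal A I : Prop := exists2 x, A x & I = gen1 A x.

(* x I *)
Definition scale x I : set K := [set y | exists2 u, I u & y = x * u].

(* The product I J: finite sums of products of an element of I and one of J. *)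
Definition idmul I J : set K :=
  [set z | exists (n : nat) (a b : 'I_n -> K),
    [/\ forall i, I (a i), forall i, J (b i) & z = \sum_(i < n) a i * b i]].

(* I^n, with I^0 = A *)
Definition idpow A I (n : nat) : set K := iter n (idmul I) A.

Definition prime_ideal A I : Prop :=
  [/\ ideal A I, I <> A
    & forall x y, A x -> A y -> I (x * y) -> I x \/ I y].

Definition radical A I : set K :=
  [set x | A x /\ exists n : nat, I (x ^+ n)].

Definition primary_ideal A I : Prop :=
  [/\ ideal A I, I <> A
    & forall x y, A x -> A y -> I (x * y) -> I x \/ radical A I y].

Definition primary_for A F I : Prop := primary_ideal A I /\ radical A I = F.

Definition basic_ideal A F I : Prop :=
  primary_for A F I /\ ~ (I `<=` idmul F F).

Definition basic_elt A F x : Prop := A x /\ basic_ideal A F (gen1 A x).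

Definition conductor B A : set K :=
  [set x | A x /\ forall y, B y -> A (x * y)].

Definition fractional_ideal A J : Prop :=
  submodule A J /\ exists c, [/\ A c, c != 0 & forall x, J x -> A (c * x)].

Definition invertible_ideal A I : Prop :=
  ideal A I /\ exists J, fractional_ideal A J /\ idmul I J = A.

(* m is the least positive integer such that I^m is principal, that is, the
   order of the class of I. *)
Definition class_order A I (m : nat) : Prop :=
  [/\ (0 < m)%N, principal A (idpow A I m)
    & forall j : nat, (0 < j < m)%N -> ~ principal A (idpow A I j)].

End SubringsAndIdeals.

Definition squarefree_int (d : int) : Prop :=
  forall n : int, (n ^+ 2 %| d)%Z -> n \is a GRing.unit.

Section QuadraticOrders.
Variable K : fieldType.

(* In the next three definitions r stands for sqrt d. *)
Definition omega (d : int) (r : K) : K :=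
  if (d == 1 %[mod 4])%Z then (1 + r) / 2%:R else r.

Definition quad_integers (d : int) (r : K) : set K := adjoinZ (omega d r).

Definition quad_order (d : int) (r : K) (f : nat) : set K :=
  adjoinZ (f%:R * omega d r).

Definition t_ (f : nat) (beta : K) (k : nat) : K := f%:R * beta ^+ k.

Definition Q_ (O : set K) (f : nat) (beta : K) (k : nat) : set K :=
  gen2 O (f%:R ^+ k) (t_ f beta k).

Definition properly_between (I Q J : set K) : Prop := I `<` Q /\ Q `<` J.

(* The position of Q relative to the chain (Q_k) attached to a generator beta
   of the power P^m of one of the two primes above f. *)
Definition located (O : set K) (f : nat) (beta : K) (Q : set K) : Prop :=
  exists2 k : nat, (0 < k)%N &
    properly_between (scale f%:R (Q_ O f beta k)) Q (Q_ O f beta k) /\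
    exists2 a : nat, (1 <= a <= f - 1)%N &
      Q = gen2 O (f%:R ^+ k.+1) (a%:R * f%:R ^+ k + t_ f beta k).

End QuadraticOrders.

(* Main.v *)
Require Import Defs.
From HB Require Import structures.
From mathcomp Require Import all_boot all_order all_algebra all_field.
From mathcomp Require Import boolp classical_sets.
From mathcomp Require Import ring.

(** Why the theorem holds. Every element of D is i + j beta modulo f D, with
    integers i and j (D_span). As beta is in P but not in conj P, this gives
    the intersection of P and conj P as f D (P_Pbar_sub), and the conductor F
    as f D (conductorE). So a basic F-primary ideal Q is f I for an O-submodule
    I of D that contains a power of f and is not contained in f D
    (basic_ideal_scale). Such an I is not contained in both P and conj P;
    exchanging the two if necessary, suppose that it is not contained in
    conj P.

    Let a be the greatest integer with I contained in P^a (level_exists). Then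
    I has an element x that is in P^a but neither in P^(a+1) nor in conj P, so
    that x D + f^n D = P^a for large n. As f D is contained in O, it follows
    that f P^a is contained in I (f_Ppow_sub). So I is the inverse image of a
    subspace of the plane P^a / f P^a over the field with f elements, and f^a
    and beta^(a+1) form a basis of this plane (Ppow_span). With k = a + 1, this
    is the plane Q_k / f Q_k up to the factor f (Q_scale_Ppow).

    If I contained beta^(a+1), or 1 when a = 0, then Q would contain the basic
    element f beta^(a+1), or f: these are basic because beta and 1 divide
    powers of f, and are not in conj P (basic_elt_intro). So the subspace is
    neither the plane nor the second axis, nor the first axis when a = 0; nor is
    it the first axis when a > 0, as then I would be contained in conj P. It is
    not 0, because I is not contained in P^(a+1). What remains is a line with a
    generator c f^a + beta^(a+1), where 1 <= c <= f - 1 (intermediate_line).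
    This is (i) and (ii). For (iii), an element of I outside f D has a
    coefficient prime to f on the generator, so the argument above applies to
    every basic ideal contained in Q and shows that it is Q (line_minimal). For
    (iv), the norm of the generator is f^a u with u prime to f, so that
    I conj I = f^a O (invertible_line).

    Powers of P are handled without ideal factorization: Ppow a is the set of
    the elements of D that become divisible by f^a after multiplication by
    some element outside P. Being prime to f is expressed for an integer as not
    being in P, and Bezout's identity with a power of f replaces the passage to
    residue fields (cancel_coprime). *)

Set Implicit Arguments.
Unset Strict Implicit.
Unset Printing Implicit Defensive.

Import Order.TTheory GRing.Theory Num.Theory.
Local Open Scope classical_set_scope.
Local Open Scope ring_scope.

(** * Generalities on subgroups, products of ideals and quadratic rings *)

(** A subgroup contained in neither of two subgroups is not contained in their
    union. *)
Lemma avoid_two (M : zmodType) (S A B : set M) :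
  (forall x y, S x -> S y -> S (x + y)) ->
  (forall x y, A y -> A (x + y) -> A x) -> (forall x y, B y -> B (x + y) -> B x) ->
  (exists2 x, S x & ~ A x) -> (exists2 y, S y & ~ B y) ->
  exists s, [/\ S s, ~ A s & ~ B s].
Proof.
move=> SD AB BB [x Sx nAx] [y Sy nBy].
have [Bx|nBx] := pselect (B x); last by exists x.
have [Ay|nAy] := pselect (A y); last by exists y.
exists (x + y); split; [exact: SD | by move/(AB _ _ Ay) | ].
by rewrite addrC => /(BB _ _ Bx).
Qed.

Section IdealProducts.
Variable K : fieldType.
Implicit Types (A I J S : set K) (x y : K).

Lemma idmul_intro I J x y : I x -> J y -> idmul I J (x * y).
Proof.
by move=> Ix Jy; exists 1%N, (fun=> x), (fun=> y); split=> //; rewrite big_ord1.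
Qed.

Lemma idmul_min I J S : S 0 -> (forall x y, S x -> S y -> S (x + y)) ->
  (forall x y, I x -> J y -> S (x * y)) -> idmul I J `<=` S.
Proof.
move=> S0 SA SM _ [n [a [b [aI bJ ->]]]].
by elim/big_ind: _ => // i _; apply: SM.
Qed.

Lemma idmul_add I J x y : idmul I J x -> idmul I J y -> idmul I J (x + y).
Proof.
move=> [n [a [b [aI bJ ->]]]] [p [c [e [cI eJ ->]]]].
exists (n + p)%N, (fun i => match split i with inl k => a k | inr k => c k end),
  (fun i => match split i with inl k => b k | inr k => e k end).
split=> [i|i|]; try by case: (split i).
rewrite big_split_ord /=; congr (_ + _); apply: eq_bigr => i _.
  by rewrite -/(unsplit (inl i)) unsplitK.
by rewrite -/(unsplit (inr i)) unsplitK.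
Qed.

Lemma idpow_exp A I x n : A 1 -> I x -> idpow A I n (x ^+ n).
Proof.
move=> A1 Ix; elim: n => [//|n IHn].
by rewrite exprS; apply: idmul_intro.
Qed.

Lemma idpow_sub A I n : ideal A I -> idpow A I n.+1 `<=` I.
Proof.
move=> [IA [I0 ID IM]].
have sub J : J `<=` A -> idmul I J `<=` I.
  by move=> JA; apply: idmul_min => // x y Ix /JA Ay; rewrite mulrC; apply: IM.
elim: n => [|n IHn]; first exact: sub.
by apply: sub => x /IHn; apply: IA.
Qed.

End IdealProducts.

Section AdjoinQuadratic.
Variables (K : fieldType) (x : K) (s n : int).
Hypothesis xE : x ^+ 2 = s%:~R * x + n%:~R.

Lemma adjoinZ_quadratic y :
  adjoinZ x y <-> exists p q : int, y = p%:~R + q%:~R * x.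
Proof.
split=> [[p ->{y}]|[p [q ->]]]; last first.
  exists (p%:P + q%:P * 'X); rewrite rmorphD rmorphM /= !map_polyC map_polyX /=.
  by rewrite !hornerE.
elim/poly_ind: p => [|p c [a [b IHp]]].
  by exists 0, 0; rewrite rmorph0 horner0 mul0r addr0.
exists (b * n + c), (a + b * s).
rewrite rmorphD rmorphM /= map_polyX map_polyC !hornerE /= IHp.
rewrite mulrDl -mulrA -expr2 xE !(rmorphD, rmorphM) /=; ring.
Qed.

Lemma adjoinZ_int (a : int) : adjoinZ x a%:~R.
Proof. by apply/adjoinZ_quadratic; exists a, 0; rewrite mul0r addr0. Qed.

Lemma adjoinZ_add y z : adjoinZ x y -> adjoinZ x z -> adjoinZ x (y + z).
Proof.
move=> [p ->] [q ->]; exists (p + q); by rewrite rmorphD hornerD.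
Qed.

Lemma adjoinZ_mul y z : adjoinZ x y -> adjoinZ x z -> adjoinZ x (y * z).
Proof.
move=> [p ->] [q ->]; exists (p * q); by rewrite rmorphM hornerM.
Qed.

End AdjoinQuadratic.

(** * The maximal order, the order O and a prime above f *)

Section PrimeAbove.
Variables (K : fieldType) (conj : {rmorphism K -> K}) (om : K) (tr nm : int).
Hypothesis omE : om ^+ 2 = tr%:~R * om + nm%:~R.
Hypothesis conj_om : conj om = tr%:~R - om.
Variable f : nat.
Hypotheses (f_prime : prime f) (f_neq0 : f%:R != 0 :> K).

Local Notation D := (adjoinZ om).
Local Notation O := (adjoinZ (f%:R * om)).

Lemma D_int (n : int) : D n%:~R. Proof. exact: adjoinZ_int omE n. Qed.
Lemma D_nat (n : nat) : D n%:R. Proof. exact: (D_int n). Qed.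
Lemma D0 : D 0. Proof. exact: (D_nat 0). Qed.
Lemma D1 : D 1. Proof. exact: (D_nat 1). Qed.
Lemma D_add x y : D x -> D y -> D (x + y). Proof. exact: adjoinZ_add. Qed.
Lemma D_mul x y : D x -> D y -> D (x * y). Proof. exact: adjoinZ_mul. Qed.
Lemma D_opp x : D x -> D (- x).
Proof. by move=> Dx; rewrite -mulN1r; apply: D_mul => //; apply: (D_int (-1)). Qed.
Lemma D_exp x n : D x -> D (x ^+ n).
Proof.
move=> Dx; elim: n => [|n IHn]; first exact: D1.
by rewrite exprS; apply: D_mul.
Qed.
Hint Resolve D_int D_nat D0 D1 D_add D_mul D_opp D_exp : core.

Lemma D_conj x : D x -> D (conj x).
Proof.
case/(adjoinZ_quadratic omE)=> p [q ->].
apply/(adjoinZ_quadratic omE); exists (p + q * tr), (- q).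
by rewrite rmorphD rmorphM /= !rmorph_int conj_om !(rmorphD, rmorphM, rmorphN) /=; ring.
Qed.
Hint Resolve D_conj : core.

Lemma conjK x : D x -> conj (conj x) = x.
Proof.
case/(adjoinZ_quadratic omE)=> p [q ->].
by rewrite !(rmorphD, rmorphM, rmorphN, rmorph_int, conj_om) /=; ring.
Qed.

Lemma norm_int x : D x -> exists n : int, x * conj x = n%:~R.
Proof.
case/(adjoinZ_quadratic omE)=> p [q ->]; exists (p ^+ 2 + p * q * tr - q ^+ 2 * nm).
rewrite !(rmorphD, rmorphM, rmorphN, rmorph_int, conj_om) /=.
(* om satisfies an equation, so ring needs one of its coefficients eliminated *)
have -> : nm%:~R = om ^+ 2 - tr%:~R * om by rewrite omE addrC addKr.
by ring.
Qed.

Lemma order_eqn : (f%:R * om) ^+ 2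
  = (f%:Z * tr)%:~R * (f%:R * om) + (f%:Z ^+ 2 * nm)%:~R.
Proof. by rewrite exprMn omE !(rmorphM, rmorphXn) /=; ring. Qed.

Lemma orderP x :
  O x <-> exists (n : int) y, D y /\ x = n%:~R + f%:R * y.
Proof.
split=> [/(adjoinZ_quadratic order_eqn)[p [q ->]]|].
  exists p, (q%:~R * om); split; last by ring.
  by apply/(adjoinZ_quadratic omE); exists 0, q; rewrite add0r.
case=> n [y [/(adjoinZ_quadratic omE)[p [q ->]] ->]].
apply/(adjoinZ_quadratic order_eqn); exists (n + f%:Z * p), q.
by rewrite rmorphD rmorphM /=; ring.
Qed.

Lemma O_sub_D x : O x -> D x.
Proof. by case/orderP=> n [y [Dy ->]]; auto. Qed.
Lemma O_int (n : int) : O n%:~R. Proof. exact: adjoinZ_int order_eqn n. Qed.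
Lemma O_nat (n : nat) : O n%:R. Proof. exact: (O_int n). Qed.
Lemma O_fD y : D y -> O (f%:R * y).
Proof. by move=> Dy; apply/orderP; exists 0, y; rewrite add0r. Qed.
Lemma O_add x y : O x -> O y -> O (x + y). Proof. exact: adjoinZ_add. Qed.
Lemma O_mul x y : O x -> O y -> O (x * y). Proof. exact: adjoinZ_mul. Qed.
Lemma O_exp x n : O x -> O (x ^+ n).
Proof.
move=> Ox; elim: n => [|n IHn]; first exact: (O_nat 1).
by rewrite exprS; apply: O_mul.
Qed.
Hint Resolve O_int O_nat O_fD O_add O_mul O_exp : core.
Lemma O_conj x : O x -> O (conj x).
Proof.
case/orderP=> n [y [Dy ->]].
by rewrite rmorphD rmorphM rmorph_int rmorph_nat; auto.
Qed.

(** All that is used of the splitting of f and of the equality P^m = beta D is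
    stated in the following hypotheses. They are preserved when conj P and
    conj beta replace P and beta. *)
Variables (P : set K) (beta : K).
Hypotheses (P_prime : prime_ideal D P) (Pf : P f%:R).
Hypotheses (Dbeta : D beta) (Pbeta : P beta) (nPbeta : ~ P (conj beta)).
Hypothesis beta_dvd : exists n z, D z /\ beta * z = f%:R ^+ n.
Hint Resolve Dbeta Pbeta : core.

Lemma P_sub_D x : P x -> D x. Proof. by case: P_prime => [[PD _] _ _]; apply: PD. Qed.
Lemma P0 : P 0. Proof. by case: P_prime => [[_ []]]. Qed.
Lemma P_add x y : P x -> P y -> P (x + y).
Proof. by case: P_prime => [[_ [_ PA _]] _ _]; apply: PA. Qed.
Lemma P_mull x y : D x -> P y -> P (x * y).
Proof. by case: P_prime => [[_ [_ _ PM]] _ _]; apply: PM. Qed.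
Lemma P_mulr x y : P x -> D y -> P (x * y).
Proof. by move=> Px Dy; rewrite mulrC; apply: P_mull. Qed.
Lemma P_fD y : D y -> P (f%:R * y). Proof. exact: P_mulr. Qed.
Hint Resolve P_add P_mull P_mulr P_fD : core.
Lemma P_opp x : P x -> P (- x).
Proof. by move=> Px; rewrite -mulN1r; apply: P_mull => //; apply: (D_int (-1)). Qed.
Lemma P_subl x y : P y -> P (x + y) -> P x.
Proof. by move=> Py Pxy; rewrite -(addrK y x); apply: P_add => //; apply: P_opp. Qed.
Lemma P_conj_subl x y : P (conj y) -> P (conj (x + y)) -> P (conj x).
Proof. by rewrite rmorphD; apply: P_subl. Qed.
Lemma nP_mul x y : D x -> D y -> ~ P x -> ~ P y -> ~ P (x * y).
Proof. by move=> Dx Dy nPx nPy; case: P_prime => [_ _ Pp] /(Pp _ _ Dx Dy)[]. Qed.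
Lemma nP1 : ~ P 1.
Proof.
case: P_prime => [[PD _] PneqD _] P1; apply: PneqD; apply/seteqP; split=> // x Dx.
by rewrite -[x]mulr1; apply: P_mull.
Qed.
Lemma nP_exp x n : D x -> ~ P x -> ~ P (x ^+ n).
Proof.
move=> Dx nPx; elim: n => [|n IHn]; first exact: nP1.
by rewrite exprS; apply: nP_mul; auto.
Qed.

(** For an integer, not being in P means being prime to f. *)
Lemma bezout_P (c : int) n : ~ P c%:~R ->
  exists A B : int, A%:~R * c%:~R + B%:~R * f%:R ^+ n = 1 :> K.
Proof.
move=> nPc.
have [/dvdzP[q cE]|ndvd] := boolP (f %| c)%Z.
  by case: nPc; rewrite cE mulrC rmorphM /=; apply: P_fD; auto.
have cop : coprimez c (f%:Z ^+ n).
  by apply: coprimezXr; rewrite coprimezE /= coprime_sym prime_coprime.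
have [[A B] /= AB] := coprimezP _ _ cop.
by exists A, B; rewrite -[RHS](rmorph1 intr) -AB rmorphD !rmorphM rmorphXn.
Qed.

Lemma P_int (c : int) : P c%:~R -> exists q : int, c = f%:Z * q.
Proof.
move=> Pc; have [/dvdzP[q ->]|ndvd] := boolP (f %| c)%Z; first by exists q; rewrite mulrC.
have cop : coprimez c f%:Z by rewrite coprimezE /= coprime_sym prime_coprime.
have [[A B] /= AB] := coprimezP _ _ cop.
case: nP1; rewrite -(rmorph1 intr) -AB rmorphD !rmorphM /=.
by apply: P_add; apply: P_mull => //; auto.
Qed.

Definition int_closed (S : set K) :=
  (forall x y, S x -> S y -> S (x + y)) /\ (forall (n : int) x, S x -> S (n%:~R * x)).

(** The residue of c is invertible modulo any power of f. This replaces all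
    divisions in the residue field and all localizations at f below. *)
Lemma cancel_coprime S (c : int) n x : int_closed S -> ~ P c%:~R ->
  S (c%:~R * x) -> S (f%:R ^+ n * x) -> S x.
Proof.
move=> [SA SZ] nPc Sc Sf; have [A [B AB]] := bezout_P n nPc.
rewrite -[x]mul1r -AB mulrDl -!mulrA.
by apply: SA; apply: SZ.
Qed.

Lemma fD_sub x : gen1 D f%:R x -> P x /\ P (conj x).
Proof.
case=> y Dy ->; split; first exact: P_fD.
by rewrite rmorphM rmorph_nat; auto.
Qed.

(** 1 and beta form a basis of D / f D: if the coefficient of om in beta were
    divisible by f, then so would be the constant one, as beta is in P, and
    beta would be in f D, hence in conj P. *)
Lemma D_span x : D x -> exists (i j : int) y,
  D y /\ x = i%:~R + j%:~R * beta + f%:R * y.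
Proof.
move=> Dx; case/(adjoinZ_quadratic omE): (Dbeta) => p [q bE].
case/(adjoinZ_quadratic omE): (Dx) => a [b ->].
have Dom : D om by apply/(adjoinZ_quadratic omE); exists 0, 1; rewrite mul1r add0r.
have nPq : ~ P q%:~R.
  case/P_int=> q' qE.
  have Pp : P p%:~R.
    apply: (@P_subl _ (q%:~R * om)); last by rewrite -bE.
    by rewrite qE rmorphM /= -mulrA; apply: P_fD; auto.
  have [p' pE] := P_int Pp; apply: nPbeta.
  suff /fD_sub[] : gen1 D f%:R beta by [].
  exists (p'%:~R + q'%:~R * om); first by auto.
  by rewrite bE pE qE !rmorphM /=; ring.
have [A [B AB]] := bezout_P 1 nPq; rewrite expr1 in AB.
exists (a - b * A * p), (b * A), (b%:~R * B%:~R * om); split; first by auto.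
have -> : b%:~R * om = (A%:~R * q%:~R + B%:~R * f%:R) * (b%:~R * om).
  by rewrite AB mul1r.
by rewrite bE !(rmorphD, rmorphN, rmorphM) /=; ring.
Qed.

(** Being in P makes the coefficient of 1 in the basis (1, beta) divisible by f,
    and being in conj P does the same for the coefficient of beta. *)
Lemma P_Pbar_sub x : P x -> P (conj x) -> gen1 D f%:R x.
Proof.
move=> Px Pcx; have [i [j [y [Dy xE]]]] := D_span (P_sub_D Px).
have [i' iE] : exists i', i = f%:Z * i'.
  apply: P_int; apply: (@P_subl _ (j%:~R * beta + f%:R * y)); first by auto.
  by rewrite addrA -xE.
have Pj : P (j%:~R * conj beta).
  move: Pcx; rewrite xE !rmorphD /= !rmorphM /= !rmorph_int rmorph_nat iE rmorphM /=.
  rewrite [_ + j%:~R * _]addrC -addrA => Pcx'; apply: P_subl Pcx'.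
  by apply: P_add; apply: P_fD; auto.
have [j' jE] : exists j', j = f%:Z * j'.
  by apply: P_int; apply: contrapT => nPj; apply: (nP_mul _ _ nPj nPbeta); auto.
exists (i'%:~R + j'%:~R * beta + y); first by auto.
by rewrite xE iE jE !rmorphM /=; ring.
Qed.

(** * The powers of P *)

(** The power P^a, that is, the inverse image in D of the ideal generated by
    f^a in the localization of D at P. *)
Definition Ppow a : set K :=
  [set x | D x /\ exists c, [/\ D c, ~ P c & gen1 D (f%:R ^+ a) (c * x)]].

Lemma Ppow_sub_D a x : Ppow a x -> D x. Proof. by case. Qed.
Lemma Ppow0 x : D x -> Ppow 0 x.
Proof.
move=> Dx; split=> //; exists 1; split; [by auto|exact: nP1|].
by exists x; rewrite // expr0 !mul1r.
Qed.
Lemma Ppow_add a x y : Ppow a x -> Ppow a y -> Ppow a (x + y).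
Proof.
case=> Dx [c [Dc nPc [z Dz cE]]] [Dy [e [De nPe [w Dw eE]]]]; split; first by auto.
exists (c * e); split; [by auto|exact: nP_mul|].
exists (e * z + c * w); first by auto.
have -> : c * e * (x + y) = e * (c * x) + c * (e * y) by ring.
by rewrite cE eE; ring.
Qed.
Lemma Ppow_mul a x y : D x -> Ppow a y -> Ppow a (x * y).
Proof.
move=> Dx [Dy [c [Dc nPc [z Dz cE]]]]; split; first by auto.
exists c; split=> //; exists (x * z); first by auto.
by rewrite mulrCA cE; ring.
Qed.
Lemma Ppow_f a : Ppow a (f%:R ^+ a).
Proof.
split; auto; exists 1; split; [by auto|exact: nP1|].
by exists 1; auto; rewrite mulrC.
Qed.
Lemma Ppow_beta a : Ppow a (beta ^+ a).
Proof.
split; auto; exists (conj beta ^+ a); split; auto.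
  exact: nP_exp (D_conj Dbeta) nPbeta.
have /P_Pbar_sub H : P (beta * conj beta) by auto.
case: H => [|z Dz zE]; first by rewrite rmorphM conjK //; auto.
by exists (z ^+ a); auto; rewrite -!exprMn -zE [beta * _]mulrC.
Qed.
Hint Resolve Ppow_sub_D Ppow_add Ppow_mul Ppow_f Ppow_beta : core.

Lemma Ppow_opp a x : Ppow a x -> Ppow a (- x).
Proof. by move=> Vx; rewrite -mulN1r; apply: Ppow_mul => //; apply: (D_int (-1)). Qed.

(** Multiplying by conj beta turns the factor w in P into a multiple of f. *)
Lemma Ppow_succ_intro a c x w : D x -> D c -> ~ P c -> c * x = f%:R ^+ a * w -> P w ->
  Ppow a.+1 x.
Proof.
move=> Dx Dc nPc cE Pw; split=> //; exists (conj beta * c); split; auto.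
  exact: nP_mul (D_conj Dbeta) Dc nPbeta nPc.
have /P_Pbar_sub[|z Dz zE] : P (conj beta * w) by auto.
  by rewrite rmorphM conjK //; apply: P_mulr => //; exact: D_conj (P_sub_D Pw).
by exists z; auto; rewrite -mulrA cE mulrCA zE exprSr mulrA.
Qed.

Lemma Ppow_succ_sub_P a x : Ppow a.+1 x -> P x.
Proof.
move=> [Dx [c [Dc nPc [z Dz cE]]]]; apply: contrapT => nPx.
by apply: (nP_mul Dc Dx nPc nPx); rewrite cE exprS -mulrA; auto.
Qed.

Lemma Ppow_succ_f a x : D x -> Ppow a.+1 (f%:R * x) <-> Ppow a x.
Proof.
move=> Dx; split=> [[_ [c [Dc nPc [z Dz cE]]]]|[_ [c [Dc nPc [z Dz cE]]]]]; split; auto.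
  exists c; split=> //; exists z => //.
  by apply: (mulfI f_neq0); rewrite mulrCA cE exprS mulrA.
by exists c; split=> //; exists z => //; rewrite mulrCA cE exprS mulrA.
Qed.

Lemma Ppow_succ_mul_f u a : D u -> Ppow a.+1 (u * f%:R ^+ a) -> P u.
Proof.
move=> Du [_ [c [Dc nPc [z Dz cE]]]]; apply: contrapT => nPu.
apply: (nP_mul Dc Du nPc nPu).
have -> : c * u = f%:R * z; last by auto.
by apply: (mulIf (expf_neq0 a f_neq0)); rewrite -mulrA cE exprS mulrAC.
Qed.

Lemma nPpow_f a : ~ Ppow a.+1 (f%:R ^+ a).
Proof. by rewrite -[_ ^+ a]mul1r => /(Ppow_succ_mul_f D1) /nP1. Qed.

Lemma gen1_int_closed a : int_closed (gen1 D a).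
Proof.
split=> [x y [z Dz ->] [w Dw ->]|n x [z Dz ->]].
  by exists (z + w); auto; rewrite mulrDr.
by exists (n%:~R * z); auto; rewrite mulrCA.
Qed.

(** The inclusion of P^a (conj P)^a in f^a D. The elements s with s x (conj y)
    in f^a D include one outside P and one outside conj P, hence one outside
    both, whose norm is prime to f. *)
Lemma Ppow_mul_conj a x y : Ppow a x -> Ppow a y -> gen1 D (f%:R ^+ a) (x * conj y).
Proof.
move=> [Dx [c [Dc nPc [z Dz cE]]]] [Dy [e [De nPe [w Dw eE]]]].
pose S := [set s | D s /\ gen1 D (f%:R ^+ a) (s * (x * conj y))].
have [|||s [[Ds [v Dv sE]] nPs nPcs]] :=
  @avoid_two _ S P [set s | P (conj s)] _ P_subl P_conj_subl _ _.
- move=> s s' [Ds Ss] [Ds' Ss']; split; auto.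
  by rewrite mulrDl; apply: (gen1_int_closed _).1.
- by exists c => //; split=> //; exists (z * conj y); auto; rewrite mulrA cE mulrA.
- exists (conj e) => /=; last by rewrite conjK.
  split; auto; exists (x * conj w); auto.
  rewrite mulrCA -rmorphM eE rmorphM rmorphXn rmorph_nat; ring.
have [n nE] := norm_int Ds.
apply: (@cancel_coprime _ n a _ (gen1_int_closed _)).
- by rewrite -nE; apply: nP_mul; auto.
- by exists (conj s * v); auto; rewrite -nE [s * _]mulrC -mulrA sE mulrCA.
- by exists (x * conj y); auto.
Qed.

(** x has exact valuation a at P and 0 at conj P. *)
Lemma norm_generic a x : Ppow a x -> ~ Ppow a.+1 x -> ~ P (conj x) ->
  exists u : int, [/\ x * conj x = f%:R ^+ a * u%:~R & ~ P u%:~R].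
Proof.
move=> Vx nVx nPcx; have Dx := Ppow_sub_D Vx.
have [n nE] := norm_int Dx.
have [c [Dc nPc [w Dw cE]]] := Vx.2.
have nPw : ~ P w by move=> Pw; apply: nVx; apply: Ppow_succ_intro cE Pw.
have [v Dv vE] := Ppow_mul_conj Vx Vx.
have fa0 : f%:R ^+ a != 0 :> K by rewrite expf_neq0.
have nPv : ~ P v.
  move=> Pv; have : P (c * v) by auto.
  have -> : c * v = w * conj x.
    by apply: (mulfI fa0); rewrite mulrCA -vE mulrA cE mulrA.
  by apply: nP_mul; auto.
suff [u vu] : exists u : int, v = u%:~R by exists u; rewrite -vu.
(* an integer that is f times an element of D is f times an integer *)
have: n%:~R = f%:R ^+ a * v by rewrite -nE.
elim: a n {Vx nVx nE c Dc nPc w Dw cE nPw vE fa0} => [|a IHa] n nE.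
  by exists n; rewrite nE mul1r.
have [q qE] : exists q, n = f%:Z * q by apply: P_int; rewrite nE exprS -mulrA; auto.
by apply: (IHa q); apply: (mulfI f_neq0); rewrite mulrA -exprS -nE qE rmorphM.
Qed.

(** Multiplying y by conj x gives a multiple of f^a, and dividing by f^a shows
    that u y is a multiple of x, where u, the norm of x divided by f^a, is
    prime to f. *)
Lemma Ppow_sub_gen2 a x y n : Ppow a x -> ~ Ppow a.+1 x -> ~ P (conj x) -> Ppow a y ->
  gen2 D x (f%:R ^+ n) y.
Proof.
move=> Vx nVx nPcx Vy; have [u [uE nPu]] := norm_generic Vx nVx nPcx.
have Dx := Ppow_sub_D Vx; have Dy := Ppow_sub_D Vy.
have [z Dz zE] := Ppow_mul_conj Vy Vx.
have uy : u%:~R * y = x * z.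
  apply: (mulfI (expf_neq0 a f_neq0)).
  by rewrite mulrA -uE mulrCA -zE; ring.
apply: (@cancel_coprime _ u n _ _ nPu).
- split=> [r s [r1 [r2 [? ? ->]]] [s1 [s2 [? ? ->]]]|c r [r1 [r2 [? ? ->]]]].
    by exists (r1 + s1), (r2 + s2); split; auto; ring.
  by exists (c%:~R * r1), (c%:~R * r2); split; auto; ring.
- by exists z, 0; split; auto; rewrite mulr0 addr0.
- by exists 0, y; split; auto; rewrite mulr0 add0r.
Qed.

(** Every class of D / P contains an integer, so w generates D / P over the
    integers. *)
Lemma int_mod_P x w : D x -> D w -> ~ P w -> exists i : int, P (x - i%:~R * w).
Proof.
have mod_P r : D r -> exists i : int, P (r - i%:~R).
  case/D_span=> i [j [v [Dv ->]]]; exists i.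
  have -> : i%:~R + j%:~R * beta + f%:R * v - i%:~R = j%:~R * beta + f%:R * v by ring.
  by auto.
move=> Dx Dw nPw; have [i Pi] := mod_P _ Dx; have [k Pk] := mod_P _ Dw.
have nPk : ~ P k%:~R.
  by move=> Pk'; apply: nPw; rewrite -(subrK k%:~R w); auto.
have [A [B AB]] := bezout_P 1 nPk; rewrite expr1 in AB.
exists (i * A); rewrite rmorphM /=.
have -> : x - i%:~R * A%:~R * w = (x - i%:~R) + f%:R * (i%:~R * B%:~R)
    + - (i%:~R * A%:~R) * (w - k%:~R).
  have -> : i%:~R * A%:~R * w
      = i%:~R * A%:~R * (w - k%:~R) + i%:~R * (A%:~R * k%:~R) by ring.
  have -> : A%:~R * k%:~R = 1 - B%:~R * f%:R :> K.
    by apply/eqP; rewrite eq_sym subr_eq AB.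
  ring.
by auto.
Qed.

(** The first coefficient is chosen to reach P^(a+1), the second one to reach
    conj P in addition; what is left is divisible by f. *)
Lemma Ppow_span a y : Ppow a y -> exists (i j : int) v,
  Ppow a v /\ y = i%:~R * f%:R ^+ a + j%:~R * beta ^+ a.+1 + f%:R * v.
Proof.
move=> Vy; have Dy := Ppow_sub_D Vy; have [c [Dc nPc [z Dz cE]]] := Vy.2.
have [i Pi] := int_mod_P Dz Dc nPc.
have Vy' : Ppow a.+1 (y - i%:~R * f%:R ^+ a).
  apply: (Ppow_succ_intro _ Dc nPc _ Pi); first by auto.
  by rewrite mulrBr cE mulrBr; ring.
have [j Pj] : exists j : int,
    P (conj (y - i%:~R * f%:R ^+ a) - j%:~R * conj (beta ^+ a.+1)).
  apply: int_mod_P; auto 8.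
  by rewrite rmorphXn; apply: nP_exp; auto.
have Vy2 : Ppow a.+1 (y - i%:~R * f%:R ^+ a - j%:~R * beta ^+ a.+1).
  by apply: Ppow_add => //; apply: Ppow_opp; apply: Ppow_mul; auto.
have [] := @P_Pbar_sub (y - i%:~R * f%:R ^+ a - j%:~R * beta ^+ a.+1).
- exact: Ppow_succ_sub_P Vy2.
- by rewrite rmorphB rmorphM rmorph_int.
move=> v Dv vE; exists i, j, v; split; last by rewrite -vE; ring.
by apply/Ppow_succ_f => //; rewrite -vE.
Qed.

(** * Submodules of O between f P^a and P^a *)

Lemma submodule_int_closed I : submodule O I -> int_closed I.
Proof. by case=> I0 IA IM; split=> // n x Ix; apply: IM; auto. Qed.

Lemma generic_exists I a : submodule O I -> I `<=` Ppow a ->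
  (exists2 x, I x & ~ Ppow a.+1 x) -> (exists2 x, I x & ~ P (conj x)) ->
  exists x, [/\ I x, ~ Ppow a.+1 x & ~ P (conj x)].
Proof.
move=> [_ IA _] IV I1 I2; have [|x [Ix nVx nPx]] :=
  @avoid_two _ I (Ppow a.+1) [set s | P (conj s)] IA _ P_conj_subl I1 I2.
  move=> x y Vy Vxy; rewrite -(addrK y x); apply: Ppow_add => //.
  exact: Ppow_opp.
by exists x.
Qed.

(** A generic element x of I satisfies P^a = x D + f^n D, and I, an O-module,
    absorbs f D. *)
Lemma f_Ppow_sub I a n y : submodule O I -> I (f%:R ^+ n) -> I `<=` Ppow a ->
  (exists2 x, I x & ~ Ppow a.+1 x) -> (exists2 x, I x & ~ P (conj x)) ->
  Ppow a y -> I (f%:R * y).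
Proof.
move=> Isub In IV I1 I2 Vy; have [_ IA IM] := Isub.
have [x [Ix nVx nPx]] := generic_exists Isub IV I1 I2.
have [z [w [Dz Dw ->]]] := Ppow_sub_gen2 n (IV _ Ix) nVx nPx Vy.
have -> : f%:R * (x * z + f%:R ^+ n * w) = f%:R * z * x + f%:R * w * f%:R ^+ n by ring.
by apply: IA; apply: IM; auto.
Qed.

Lemma gen2_submodule x y : submodule O (gen2 O x y).
Proof.
split=> [|r s [r1 [r2 [? ? ->]]] [s1 [s2 [? ? ->]]]|c r Oc [r1 [r2 [? ? ->]]]].
- by exists 0, 0; split; [exact: (O_int 0)|exact: (O_int 0)|rewrite !mulr0 addr0].
- by exists (r1 + s1), (r2 + s2); split; auto; ring.
- by exists (c * r1), (c * r2); split; auto; ring.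
Qed.

Lemma gen2_l x y : gen2 O x y x.
Proof.
by exists 1, 0; split; [exact: (O_int 1)|exact: (O_int 0)|rewrite mulr1 mulr0 addr0].
Qed.
Lemma gen2_r x y : gen2 O x y y.
Proof.
by exists 0, 1; split; [exact: (O_int 0)|exact: (O_int 1)|rewrite mulr1 mulr0 add0r].
Qed.

Lemma gen2_min (I : set K) x y : submodule O I -> I x -> I y -> gen2 O x y `<=` I.
Proof.
move=> [_ IA IM] Ix Iy z [u [v [Ou Ov ->]]].
by apply: IA; rewrite mulrC; apply: IM.
Qed.

Lemma nP_conj_beta_exp a : ~ P (conj (beta ^+ a)).
Proof. by rewrite rmorphXn; apply: nP_exp; auto. Qed.

(** The submodule on the left contains the basis of P^a / f P^a, and f P^a
    because f^a is not in P^(a+1) and beta^(a+1) is not in conj P. *)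
Lemma gen2_O_Ppow a : gen2 O (f%:R ^+ a) (beta ^+ a.+1) = Ppow a.
Proof.
have IV : gen2 O (f%:R ^+ a) (beta ^+ a.+1) `<=` Ppow a.
  move=> _ [u [v [Ou Ov ->]]]; have Du := O_sub_D Ou; have Dv := O_sub_D Ov.
  have Vb : Ppow a (beta ^+ a.+1) by rewrite exprS; auto.
  by rewrite [_ * u]mulrC [_ * v]mulrC; auto.
apply/seteqP; split=> // y /Ppow_span[i [j [v [Vv ->]]]].
have [I0 IA IM] := gen2_submodule (f%:R ^+ a) (beta ^+ a.+1).
apply: (IA); first by apply: (IA); apply: IM; auto; [exact: gen2_l|exact: gen2_r].
apply: (@f_Ppow_sub _ a a) Vv => //; first exact: gen2_l.
- by exists (f%:R ^+ a); [exact: gen2_l|exact: nPpow_f].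
- by exists (beta ^+ a.+1); [exact: gen2_r|exact: nP_conj_beta_exp].
Qed.

(** * Basic ideals and basic elements *)

Lemma O_P_sub x : O x -> P x -> gen1 D f%:R x.
Proof.
case/orderP=> n [y [Dy ->]] Px.
have [q qE] : exists q, n = f%:Z * q by apply: P_int; apply: P_subl Px; auto.
by exists (q%:~R + y); auto; rewrite qE rmorphM /= mulrDr.
Qed.

Lemma nP_norm x : O x -> ~ P x -> ~ P (x * conj x).
Proof.
move=> Ox nPx; have Dx := O_sub_D Ox; apply: nP_mul; auto.
by move/(O_P_sub (O_conj Ox))/fD_sub => [_]; rewrite conjK.
Qed.

(** So O is a proper subring of D. *)
Lemma nO_beta : ~ O beta.
Proof. by move=> Ob; have [] := fD_sub (O_P_sub Ob Pbeta). Qed.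

Lemma conductorE : conductor D O = gen1 D f%:R.
Proof.
apply/seteqP; split=> x.
  case=> Ox xD; apply: O_P_sub => //; apply: contrapT => nPx.
  (* the norm of x, prime to f, and f would both bring beta into O *)
  have [n nE] := norm_int (O_sub_D Ox).
  apply: nO_beta; apply: (@cancel_coprime _ n 1) => //.
  - by split=> *; auto.
  - by rewrite -nE; apply: nP_norm.
  - rewrite -nE [x * _]mulrC -mulrA; apply: O_mul; first exact: O_conj.
    exact: xD.
  - by rewrite expr1; auto.
by case=> y Dy ->; split=> [|z Dz]; rewrite -?mulrA; auto.
Qed.

Local Notation F := (conductor D O).

Lemma idmulFF : idmul F F = gen1 D (f%:R ^+ 2).
Proof.
rewrite conductorE; apply/seteqP; split; last move=> x.
   apply: idmul_min => [||_ _ [y Dy ->] [z Dz ->]].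
  - by exists 0; rewrite ?mulr0.
  - exact: (gen1_int_closed _).1.
  - by exists (y * z); auto; ring.
case=> y Dy ->; rewrite expr2 -mulrA; apply: idmul_intro; last by exists y.
by exists 1; rewrite ?mulr1.
Qed.

(** The ideal f y O contains a power of f times D, so its radical is F. As an
    element of O outside F has norm prime to f, it can be cancelled modulo this
    ideal, which is therefore primary. *)
Lemma basic_elt_intro y z n : D y -> D z -> y * z = f%:R ^+ n ->
  ~ gen1 D f%:R y -> basic_elt O F (f%:R * y).
Proof.
move=> Dy Dz yz nfy.
have fyP x : gen1 O (f%:R * y) x -> gen1 D f%:R x.
  by case=> u /O_sub_D Du ->; exists (y * u); auto; rewrite mulrA.
have fyO : gen1 O (f%:R * y) `<=` O.
  by move=> x [u Ou ->]; auto.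
have fyM c x : O c -> gen1 O (f%:R * y) x -> gen1 O (f%:R * y) (c * x).
  by move=> Oc [u Ou ->]; exists (c * u); auto; rewrite mulrCA.
have fyS : submodule O (gen1 O (f%:R * y)).
  split=> // [|_ _ [u Ou ->] [v Ov ->]].
    by exists 0; rewrite ?mulr0 //; exact: (O_int 0).
  by exists (u + v); auto; rewrite mulrDr.
have fyn w : D w -> gen1 O (f%:R * y) (f%:R ^+ n.+2 * w).
  move=> Dw; exists (f%:R * (z * w)); auto.
  by rewrite !exprS -yz; ring.
have rad : radical O (gen1 O (f%:R * y)) = gen1 D f%:R.
  apply/seteqP; split=> x.
    case=> Ox [j /fyP /fD_sub[Px _]]; apply: O_P_sub => //.
    by apply: contrapT => nPx; apply: nP_exp Px => //; apply: O_sub_D.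
  case=> w Dw ->; split; auto; exists n.+2; rewrite exprMn; auto.
split; first by auto.
split; last first.
  move=> sub; apply: nfy; have : gen1 O (f%:R * y) (f%:R * y).
    by exists 1; rewrite ?mulr1 //; exact: (O_int 1).
  move/sub; rewrite idmulFF => -[w Dw]; rewrite expr2 -mulrA => /(mulfI f_neq0) ->.
  by exists w.
split; last by rewrite conductorE.
split=> //.
  move=> E; have /fyP /fD_sub[/nP1] : gen1 O (f%:R * y) 1 by rewrite E; exact: (O_int 1).
  by [].
move=> x x' Ox Ox' xx'.
have [Px'|nPx'] := pselect (P x'); [right|left].
  by rewrite rad; apply: O_P_sub.
have [u uE] := norm_int (O_sub_D Ox').
apply: (@cancel_coprime _ u n.+2 _ (submodule_int_closed fyS)).
- by rewrite -uE; apply: nP_norm.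
- have -> : u%:~R * x = conj x' * (x * x') by rewrite -uE; ring.
  by apply: fyM => //; apply: O_conj.
- by apply: fyn; apply: O_sub_D.
Qed.

(** Q is contained in F = f D and not in F^2 = f^2 D. *)
Lemma basic_ideal_scale Q : basic_ideal O F Q -> exists2 I : set K,
  forall x, I x <-> Q (f%:R * x) &
  [/\ Q = scale f%:R I, submodule O I, I `<=` D, exists n, I (f%:R ^+ n)
    & exists2 x, I x & ~ gen1 D f%:R x].
Proof.
case=> [[[[QO [Q0 QA QM]] _ _] rad] nQ].
pose I := [set x | Q (f%:R * x)]; exists I => //.
have QF x : Q x -> gen1 D f%:R x.
  by move=> Qx; rewrite -conductorE -rad; split; [exact: QO|exists 1%N].
split.
- apply/seteqP; split=> x; last by case=> y Iy ->.
  by move=> Qx; have [y Dy xE] := QF _ Qx; exists y; rewrite /I /= -?xE.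
- split=> [|x y Ix Iy|c x Oc Ix]; rewrite /I /= ?mulr0 ?mulrDr //; first exact: QA.
  by rewrite mulrCA; apply: QM.
- by move=> x /QF[y Dy] /(mulfI f_neq0) ->.
- have [_ [n Qn]] : radical O Q f%:R.
    by rewrite rad conductorE; exists 1; rewrite ?mulr1.
  by exists n; apply: QM.
- apply: contrapT => H; apply: nQ => x Qx; have [y Dy xE] := QF _ Qx.
  have [z Dz yE] : gen1 D f%:R y.
    by apply: contrapT => ny; apply: H; exists y => //; rewrite /I /= -xE.
  by rewrite idmulFF; exists z => //; rewrite xE yE mulrA.
Qed.

(** As f^n is not in P^(n+1), the inclusion of I in P^a fails for some a. *)
Lemma level_exists I n : I `<=` D -> I (f%:R ^+ n) ->
  exists2 a, I `<=` Ppow a & exists2 x, I x & ~ Ppow a.+1 x.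
Proof.
move=> ID In; have : ~ (I `<=` Ppow n.+1) by move=> /(_ _ In) /nPpow_f.
elim: n.+1 => [|j IHj nI]; first by case=> x Ix; apply: Ppow0; apply: ID.
have [Ij|/IHj//] := pselect (I `<=` Ppow j).
exists j => //; apply: contrapT => H; apply: nI => x Ix.
by apply: contrapT => nVx; apply: H; exists x.
Qed.

Lemma scale_gen2 (A : set K) x y z : scale x (gen2 A y z) = gen2 A (x * y) (x * z).
Proof.
apply/seteqP; split=> [_ [_ [u [v [Au Av ->]]] ->]|_ [u [v [Au Av ->]]]].
  by exists u, v; split=> //; ring.
by exists (y * u + z * v); [exists u, v|ring].
Qed.

Lemma Q_scale_Ppow a : Q_ O f beta a.+1 = scale f%:R (Ppow a).
Proof. by rewrite -gen2_O_Ppow scale_gen2 -exprS. Qed.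

(** * Lines in the plane P^a / f P^a *)

Local Notation line_gen a c := (c%:R * f%:R ^+ a + beta ^+ a.+1).

(** The inverse image in Ppow a of the line spanned by line_gen a c in the
    plane Ppow a / f Ppow a. *)
Definition line a (c : nat) : set K :=
  [set x | exists (j : int) v, Ppow a v /\ x = j%:~R * line_gen a c + f%:R * v].

(** In the basis (f^a, beta^(a+1)) of the plane Ppow a / f Ppow a, an
    intermediate module is a line. It is not the first axis: for a = 0 it
    would contain 1, and for a > 0 its elements would all be in conj P. It is
    not the second axis, which contains beta^(a+1). Hence it has a generator
    whose second coordinate is 1 and whose first one is not 0. *)
Lemma intermediate_line I a n : submodule O I -> I (f%:R ^+ n) -> I `<=` Ppow a ->
  (exists2 x, I x & ~ Ppow a.+1 x) -> (exists2 x, I x & ~ P (conj x)) ->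
  ~ I 1 -> ~ I (beta ^+ a.+1) ->
  exists c : nat, [/\ (1 <= c <= f - 1)%N, I = line a c & ~ P (conj (line_gen a c))].
Proof.
move=> Isub In IV I1 I2 nI1 nIb; have Izm := submodule_int_closed Isub.
have fVI v : Ppow a v -> I (f%:R * v).
  by move=> Vv; apply: f_Ppow_sub Isub In IV I1 I2 Vv.
have [I0 IA IM] := Isub.
have I_opp x : I x -> I (- x).
  by move=> Ix; rewrite -mulN1r; apply: (IM (-1)) => //; exact: (O_int (-1)).
have [x [Ix nVx nPx]] := generic_exists Isub IV I1 I2.
have [i [j [v [Vv xE]]]] := Ppow_span (IV _ Ix); have Dv := Ppow_sub_D Vv.
have Vb : Ppow a.+1 (j%:~R * beta ^+ a.+1) by auto.
have nPi : ~ P i%:~R.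
  case/P_int=> q qE; apply: nVx; rewrite xE.
  apply: Ppow_add; last exact/(Ppow_succ_f _ (Ppow_sub_D Vv)).
  by apply: Ppow_add => //; rewrite qE rmorphM /= [_ * q%:~R]mulrC -mulrA -exprS; auto.
have Iij : I (i%:~R * f%:R ^+ a + j%:~R * beta ^+ a.+1).
  rewrite -(addrK (f%:R * v) (_ + _)) -xE; apply: IA => //.
  by rewrite -mulrN; apply: fVI; apply: Ppow_opp.
have nPj : ~ P j%:~R.
  case/P_int=> q qE; have Vq : Ppow a (q%:~R * beta ^+ a.+1) by rewrite exprS; auto.
  have fIj : I (j%:~R * beta ^+ a.+1).
    by rewrite qE rmorphM /= -mulrA; apply: fVI.
  case: a => [|a] in IV I1 fVI xE Vv Iij fIj Vq {Vb nVx nIb} *.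
    apply: nI1; apply: (@cancel_coprime I i 1 _ Izm nPi).
      by rewrite -(addrK (j%:~R * beta ^+ 1) (_ * 1)); apply: IA => //; apply: I_opp.
    by apply: fVI; exact: (Ppow_f 0).
  apply: nPx; rewrite xE exprS qE rmorphM /= -mulrA.
  have -> : i%:~R * (f%:R * f%:R ^+ a) + f%:R * (q%:~R * beta ^+ a.+2) + f%:R * v
     = f%:R * (i%:~R * f%:R ^+ a + q%:~R * beta ^+ a.+2 + v) by ring.
  by apply: (fD_sub _).2; exists (i%:~R * f%:R ^+ a + q%:~R * beta ^+ a.+2 + v); auto 6.
(* A is an inverse of j modulo f, and c is the residue of i A modulo f *)
have [A [B AB]] := bezout_P 1 nPj; rewrite expr1 in AB.
have nPA : ~ P A%:~R by move=> PA; apply: nP1; rewrite -AB; auto.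
pose q := ((i * A) %/ f)%Z; pose c := `|((i * A) %% f)%Z|%N.
have f0 : f%:Z != 0 by rewrite -lt0n prime_gt0.
have cE : c%:R = i%:~R * A%:~R - q%:~R * f%:R :> K.
  have -> : c%:R = ((i * A) %% f)%Z%:~R :> K.
    by rewrite -[in RHS](gez0_abs (modz_ge0 (i * A) f0)).
  by rewrite /modz rmorphB !rmorphM.
have nPc : ~ P c%:R.
  rewrite cE => H; apply: (@nP_mul i%:~R A%:~R); auto.
  by apply: P_subl H; apply: P_opp; auto.
have cf : (1 <= c <= f - 1)%N.
  rewrite lt0n; apply/andP; split.
    by apply/eqP => c0; apply: nPc; rewrite c0; apply: P0.
  rewrite leq_subRL ?prime_gt0 // add1n -ltz_nat /c gez0_abs ?modz_ge0 //.
  by rewrite ltz_mod.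
have Iy0 : I (line_gen a c).
  have -> : line_gen a c = A%:~R * (i%:~R * f%:R ^+ a + j%:~R * beta ^+ a.+1)
      + f%:R * (B%:~R * beta ^+ a.+1 - q%:~R * f%:R ^+ a).
    have bE : beta ^+ a.+1 = (A%:~R * j%:~R + B%:~R * f%:R) * beta ^+ a.+1.
      by rewrite AB mul1r.
    by rewrite cE {1}bE; ring.
  apply: IA; first by apply: IM; auto.
  by apply: fVI; apply: Ppow_add; [rewrite exprS; auto | apply: Ppow_opp; auto].
(* otherwise f^a, and with it beta^(a+1), would be in I *)
have If1 k : I (k%:~R * f%:R ^+ a) -> P k%:~R.
  move=> Ik; apply: contrapT => nPk; apply: nIb.
  have Ifa : I (f%:R ^+ a).
    by apply: (@cancel_coprime I k 1 _ Izm nPk); rewrite ?expr1; auto.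
  have -> : beta ^+ a.+1 = line_gen a c - c%:R * f%:R ^+ a by rewrite addrC addKr.
  by apply: IA => //; apply: I_opp; apply: IM.
have IE : I = line a c.
  apply/seteqP; split=> y; last first.
    by case=> k [w [Vw ->]]; apply: (IA); [apply: IM|apply: fVI].
  move=> Iy; have [h [k [w [Vw yE]]]] := Ppow_span (IV _ Iy).
  have [r rE] : exists r, h - k * c = f%:Z * r.
    apply: P_int; apply: If1.
    have -> : (h - k * c)%:~R * f%:R ^+ a = y + - (k%:~R * line_gen a c + f%:R * w).
      by rewrite yE rmorphB rmorphM /=; ring.
    by apply: (IA) => //; apply: I_opp; apply: (IA); [apply: IM|apply: fVI].
  exists k, (r%:~R * f%:R ^+ a + w); split; first by auto.
  have hE : h = k * c + f%:Z * r by rewrite -rE addrC subrK.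
  by rewrite yE hE rmorphD !rmorphM /=; ring.
exists c; split => // Pc; apply: nPx; move: Ix; rewrite IE => -[k [w [Vw ->]]].
have Dw := Ppow_sub_D Vw.
by rewrite rmorphD !rmorphM /= rmorph_int rmorph_nat; auto.
Qed.

Section GenericLine.
Variables a c : nat.
Hypotheses (c_range : (1 <= c <= f - 1)%N) (nPgen : ~ P (conj (line_gen a c))).

Lemma Ppow_line_gen : Ppow a (line_gen a c).
Proof. by rewrite exprS; auto. Qed.

Lemma line_sub_Ppow : line a c `<=` Ppow a.
Proof. by move=> _ [j [v [Vv ->]]]; have := Ppow_line_gen; auto. Qed.

Lemma nPpow_line_gen (j : int) : ~ P j%:~R -> ~ Ppow a.+1 (j%:~R * line_gen a c).
Proof.
move=> nPj Vy; have nPc : ~ P c%:R.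
  move=> /(@P_int c%:Z)[q qE].
  have : (f %| c%:Z)%Z by apply/dvdzP; exists q; rewrite mulrC.
  rewrite /dvdz /= => /dvdn_leq; case/andP: c_range => c0.
  by rewrite (leq_subRL _ (prime_gt0 f_prime)) => cf /(_ c0); rewrite leqNgt cf.
apply: (nP_mul _ _ nPj nPc); auto.
apply: (@Ppow_succ_mul_f _ a); first by auto.
have -> : j%:~R * c%:R * f%:R ^+ a
    = j%:~R * line_gen a c + - (j%:~R * beta ^+ a.+1) by ring.
by apply: Ppow_add => //; apply: Ppow_opp; auto.
Qed.

Lemma line_gen_in : line a c (line_gen a c).
Proof.
exists 1, 0; split; last by rewrite mulr0 addr0 mul1r.
by rewrite -[0](mul0r (f%:R ^+ a)); auto.
Qed.

Lemma f_Ppow_sub_line v : Ppow a v -> line a c (f%:R * v).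
Proof. by move=> Vv; exists 0, v; rewrite mul0r add0r. Qed.

Lemma line_submodule : submodule O (line a c).
Proof.
split=> [|_ _ [j [v [Vv ->]]] [i [w [Vw ->]]]|x y /orderP[n [z [Dz ->]]] Ly].
- by exists 0, (0 * f%:R ^+ a); split; [auto|rewrite !mul0r mulr0 addr0].
- by exists (j + i), (v + w); split; [auto|rewrite rmorphD /=; ring].
have Vy := line_sub_Ppow Ly; case: Ly => j [v [Vv yE]].
exists (n * j), (n%:~R * v + z * y); split; first by auto.
by rewrite mulrDl {1}yE rmorphM /=; ring.
Qed.

(** Modulo P^(a+1), only the coefficient of line_gen a c matters: it would be
    divisible by f, and then so would be beta^(a+1), which is not in conj P. *)
Lemma beta_exp_notin_line : ~ line a c (beta ^+ a.+1).
Proof.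
case=> j [v [Vv bE]]; have Dv := Ppow_sub_D Vv.
have [q qE] : exists q, j = f%:Z * q.
  apply: P_int; apply: contrapT => /nPpow_line_gen; apply.
  have -> : j%:~R * line_gen a c = beta ^+ a.+1 + - (f%:R * v).
    by rewrite [in RHS]bE addrK.
  by apply: Ppow_add => //; apply: Ppow_opp; apply/Ppow_succ_f.
apply: (@nP_conj_beta_exp a.+1); rewrite bE qE.
apply: (fD_sub _).2; exists (q%:~R * line_gen a c + v).
  by have := Ppow_sub_D Ppow_line_gen; auto.
by rewrite rmorphM /=; ring.
Qed.

(** The coefficient of line_gen a c in an element outside f D is prime to f,
    so that this element is as generic as line_gen a c itself. Hence a
    submodule containing it contains f Ppow a, and then line_gen a c. *)
Lemma line_minimal I n : submodule O I -> I `<=` line a c -> I (f%:R ^+ n) ->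
  (exists2 x, I x & ~ gen1 D f%:R x) -> I = line a c.
Proof.
move=> Isub IL In [x Ix nfx]; have Dgen := Ppow_sub_D Ppow_line_gen.
have [j [v [Vv xE]]] := IL _ Ix; have Dv := Ppow_sub_D Vv.
have nPj : ~ P j%:~R.
  case/P_int=> q qE; apply: nfx; exists (q%:~R * line_gen a c + v); first by auto.
  by rewrite xE qE rmorphM /=; ring.
have fVI w : Ppow a w -> I (f%:R * w).
  move=> Vw; apply: (@f_Ppow_sub _ a n) Vw => //.
  - by move=> z /IL/line_sub_Ppow.
  - exists x => // Vx; apply: (nPpow_line_gen nPj).
    have -> : j%:~R * line_gen a c = x + - (f%:R * v) by rewrite xE addrK.
    by apply: Ppow_add => //; apply: Ppow_opp; apply/Ppow_succ_f.
  - exists x => //; rewrite xE rmorphD !rmorphM /= rmorph_int rmorph_nat => Px.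
    by apply: (@nP_mul j%:~R (conj (line_gen a c))); auto; apply: P_subl Px; auto.
have [_ IA IM] := Isub; have Igen : I (line_gen a c).
  apply: (@cancel_coprime _ j 1 _ (submodule_int_closed Isub) nPj); last first.
    by rewrite expr1; apply: fVI; apply: Ppow_line_gen.
  have -> : j%:~R * line_gen a c = x + f%:R * (- v) by rewrite xE mulrN addrK.
  by apply: IA => //; apply: fVI; apply: Ppow_opp.
apply/seteqP; split=> // _ [i [w [Vw ->]]].
by apply: IA; [apply: IM|apply: fVI].
Qed.

(** The submodule on the right is contained in the line and not in f D, so it is
    the whole line by minimality. *)
Lemma line_gen2 : line a c = gen2 O (f%:R ^+ a.+1) (line_gen a c).
Proof.
apply/esym; apply: (@line_minimal _ a.+1).
- exact: gen2_submodule.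
- apply: gen2_min; [exact: line_submodule| |exact: line_gen_in].
  by rewrite exprS; apply: f_Ppow_sub_line.
- exact: gen2_l.
- by exists (line_gen a c); [exact: gen2_r|case/fD_sub].
Qed.

Lemma located_line : located O f beta (scale f%:R (line a c)).
Proof.
exists a.+1 => //; rewrite Q_scale_Ppow; split; last first.
  exists c => //; rewrite line_gen2 scale_gen2 -exprS; congr (gen2 _ _ _).
  by rewrite /t_ mulrDr mulrCA -exprS.
split; split.
- by move=> _ [_ [v Vv ->] ->]; exists (f%:R * v) => //; apply: f_Ppow_sub_line.
- move=> /(_ (f%:R * line_gen a c)) [].
    by exists (line_gen a c); first exact: line_gen_in.
  move=> _ [v Vv ->] /(mulfI f_neq0) genE; apply: nPgen.
  by apply: (fD_sub _).2; exists v => //; apply: Ppow_sub_D Vv.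
- by move=> _ [x Lx ->]; exists x => //; apply: line_sub_Ppow.
- move=> /(_ (f%:R * beta ^+ a.+1)) [].
    by exists (beta ^+ a.+1); rewrite // exprS; auto.
  by move=> x Lx /(mulfI f_neq0) bE; apply: beta_exp_notin_line; rewrite bE.
Qed.

(** The product of line a c and its conjugate is f^a O: modulo f^(a+1) D it is
    generated by the norm of line_gen a c, which is f^a times an integer prime
    to f. So f^(-a-1) conj (line a c) is the inverse of f (line a c). *)
Lemma invertible_line : invertible_ideal O (scale f%:R (line a c)).
Proof.
have [L0 LA LM] := line_submodule; have LD := line_sub_Ppow.
split.
  split=> [_ [x Lx ->]|]; first by apply: O_fD; apply: Ppow_sub_D (LD _ Lx).
  split=> [|_ _ [x Lx ->] [y Ly ->]|b _ Ob [x Lx ->]].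
  - by exists 0; rewrite ?mulr0.
  - by exists (x + y); rewrite ?mulrDr //; apply: LA.
  - by exists (b * x); [apply: LM|rewrite mulrCA].
have nVgen : ~ Ppow a.+1 (line_gen a c).
  by rewrite -[line_gen a c]mul1r; apply: (nPpow_line_gen (j := 1)) nP1.
have [u [uE nPu]] := norm_generic Ppow_line_gen nVgen nPgen.
pose e : K := (f%:R ^+ a.+1)^-1.
have fa0 m : f%:R ^+ m != 0 :> K by rewrite expf_neq0.
exists [set z | exists2 y, line a c y & z = e * conj y]; split.
  split; first split.
  - by exists 0; rewrite ?rmorph0 ?mulr0.
  - by move=> _ _ [y Ly ->] [z Lz ->]; exists (y + z); rewrite ?rmorphD ?mulrDr; auto.
  - move=> b _ Ob [y Ly ->]; exists (conj b * y); first by apply: LM => //; exact: O_conj.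
    by rewrite rmorphM conjK ?mulrA 1?[e * b]mulrC //; exact: O_sub_D.
  (* f^(a+1) clears the denominator, the last f brings conj D into O *)
  exists (f%:R ^+ a.+2); split; auto.
  move=> _ [y Ly ->]; rewrite exprS -mulrA mulVKf //.
  by apply: O_fD; apply: D_conj; apply: Ppow_sub_D (LD _ Ly).
have mul_conj x y : line a c x -> line a c y ->
    exists2 o, O o & x * conj y = f%:R ^+ a * o.
  move=> [j [v [Vv xE]]] Ly; have Vy := LD _ Ly; case: Ly => i [w [Vw yE]].
  have [d1 Dd1 d1E] := Ppow_mul_conj (Ppow_mul (D_int j) Ppow_line_gen) Vw.
  have [d2 Dd2 d2E] := Ppow_mul_conj Vv Vy.
  exists ((j * i)%:~R * u%:~R + f%:R * (d1 + d2)); first by auto.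
  have -> : x * conj y = j%:~R * i%:~R * (line_gen a c * conj (line_gen a c))
      + f%:R * (j%:~R * line_gen a c * conj w) + f%:R * (v * conj y).
    have cyE : conj y = i%:~R * conj (line_gen a c) + f%:R * conj w.
      by rewrite yE rmorphD (rmorphM _ i%:~R) (rmorphM _ f%:R) /=
        rmorph_int rmorph_nat.
    by rewrite xE mulrDl {1}cyE; ring.
  by rewrite uE d1E d2E rmorphM /=; ring.
apply/seteqP; split.
  apply: idmul_min; [exact: (O_nat 0)|exact: O_add|move=> _ _ [x Lx ->] [y Ly ->]].
  have [o Oo oE] := mul_conj _ _ Lx Ly.
  suff -> : f%:R * x * (e * conj y) = o by [].
  have -> : f%:R * x * (e * conj y) = f%:R * (x * conj y) * e by ring.
  by rewrite oE mulrA -exprS mulrAC /e mulfV // mul1r.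
(* u and f^(a+2) are coprime and in the product *)
move=> o Oo; have [A [B AB]] := bezout_P a.+2 nPu.
have -> : o = f%:R * (o * A%:~R * line_gen a c) * (e * conj (line_gen a c))
    + f%:R * (o * B%:~R * f%:R ^+ a.+1) * (e * conj (f%:R ^+ a.+1)).
  have -> : f%:R * (o * A%:~R * line_gen a c) * (e * conj (line_gen a c))
      = f%:R * (line_gen a c * conj (line_gen a c)) * e * (o * A%:~R) by ring.
  have -> : f%:R * (line_gen a c * conj (line_gen a c)) = f%:R ^+ a.+1 * u%:~R.
    by rewrite uE exprS mulrA.
  rewrite rmorphXn rmorph_nat.
  have ef : f%:R ^+ a.+1 * e = 1 by rewrite mulfV.
  have -> : f%:R ^+ a.+1 * u%:~R * e * (o * A%:~R)
      = (f%:R ^+ a.+1 * e) * (o * (A%:~R * u%:~R)) by ring.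
  have -> : f%:R * (o * B%:~R * f%:R ^+ a.+1) * (e * f%:R ^+ a.+1)
      = (f%:R ^+ a.+1 * e) * (o * (B%:~R * (f%:R * f%:R ^+ a.+1))) by ring.
  by rewrite ef !mul1r -exprS -mulrDr AB mulr1.
have Lf : line a c (f%:R ^+ a.+1) by rewrite exprS; apply: f_Ppow_sub_line.
apply: idmul_add; apply: idmul_intro.
- by exists (o * A%:~R * line_gen a c) => //; apply: LM; [auto|exact: line_gen_in].
- by exists (line_gen a c) => //; exact: line_gen_in.
- by exists (o * B%:~R * f%:R ^+ a.+1) => //; apply: LM; auto.
- by exists (f%:R ^+ a.+1).
Qed.

End GenericLine.

(** By maximality of a, the module I with Q = f I lies between f Ppow a and
    Ppow a. It contains neither 1 nor a power of beta, because f beta^k is a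
    basic element, so that it is a generic line. *)
Lemma not_sub_Pbar_line Q : basic_ideal O F Q ->
  (forall t, Q t -> ~ basic_elt O F t) ->
  (exists2 x, Q (f%:R * x) & ~ P (conj x)) ->
  exists a (c : nat), [/\ (1 <= c <= f - 1)%N, ~ P (conj (line_gen a c))
    & Q = scale f%:R (line a c)].
Proof.
move=> Qb Qnb I2.
have [I IQ [QE Isub ID [n In] _]] := basic_ideal_scale Qb.
have {}I2 : exists2 x, I x & ~ P (conj x) by case: I2 => x /IQ Ix; exists x.
have nIb y z N : D y -> D z -> y * z = f%:R ^+ N -> ~ P (conj y) -> ~ I y.
  move=> Dy Dz yz nPy Iy; apply: (Qnb (f%:R * y)); first exact/IQ.
  by apply: basic_elt_intro yz _ => //; case/fD_sub.
have nI1 : ~ I 1.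
  by apply: (@nIb 1 1 0); rewrite ?mulr1 ?rmorph1; auto; exact: nP1.
have nIbeta a : ~ I (beta ^+ a).
  have [N [z [Dz zE]]] := beta_dvd.
  apply: (@nIb _ (z ^+ a) (N * a)%N); auto; first by rewrite -exprMn zE exprM.
  exact: nP_conj_beta_exp.
have [a IV I1] := level_exists ID In.
have [c [cf IE nPgen]] := intermediate_line Isub In IV I1 I2 nI1 (@nIbeta a.+1).
by exists a, c; rewrite -IE.
Qed.

Lemma located_minimal_invertible Q : basic_ideal O F Q ->
  (forall t, Q t -> ~ basic_elt O F t) ->
  (exists2 x, Q (f%:R * x) & ~ P (conj x)) ->
  [/\ located O f beta Q,
      forall Q' : set K, basic_ideal O F Q' -> Q' `<=` Q -> Q' = Q
    & invertible_ideal O Q].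
Proof.
move=> Qb Qnb I2; have [a [c [cf nPgen QE]]] := not_sub_Pbar_line Qb Qnb I2.
rewrite QE; split; [exact: located_line| |exact: invertible_line].
move=> Q' Qb' sub.
have [I IQ [-> Isub ID [n In] I1]] := basic_ideal_scale Qb'; congr scale.
apply: (line_minimal cf nPgen Isub _ In I1) => x /IQ/sub[y Ly].
by move/(mulfI f_neq0) => ->.
Qed.

End PrimeAbove.

(** * Quadratic fields *)

Lemma omega_quadratic (K : fieldType) (conj : {rmorphism K -> K}) (d : int) (r : K) :
  2 != 0 :> K -> r ^+ 2 = d%:~R -> conj r = - r ->
  exists tr nm : int, omega d r ^+ 2 = tr%:~R * omega d r + nm%:~R
    /\ conj (omega d r) = tr%:~R - omega d r.
Proof.
move=> K2 rE conj_r; rewrite /omega; case: ifP => [|_]; last first.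
  by exists 0, d; rewrite mul0r add0r sub0r.
rewrite eqz_mod_dvd => /dvdzP[q dq].
have K4 : 4 != 0 :> K by rewrite (natrM K 2 2) mulf_neq0.
have sE : r ^+ 2 = q%:~R * 4 + 1.
  by rewrite rE -(subrK 1 d) dq rmorphD rmorphM.
exists 1, q; split.
  by rewrite expr_div_n sqrrD sE; field; rewrite K2.
by rewrite rmorphM fmorphV rmorphD rmorph1 rmorph_nat conj_r; field.
Qed.

Theorem theorem4p7
  (d : int) (d_squarefree : squarefree_int d) (d_neq1 : d <> 1)
  (K : fieldExtType rat) (sqrtd : K)
  (sqrtdE : sqrtd ^+ 2 = d%:~R) (K_gen : <<1; sqrtd>>%VS = fullv)
  (conj : {rmorphism K -> K}) (conj_sqrtd : conj sqrtd = - sqrtd)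
  (f : nat) (f_prime : prime f) :
  let D := quad_integers d sqrtd in
  let O := quad_order d sqrtd f in
  let F := conductor D O in
  forall (P : set K)
    (P_prime : prime_ideal D P) (Pbar_prime : prime_ideal D (conj @` P))
    (P_neq : P <> conj @` P)
    (f_split : gen1 D f%:R = idmul P (conj @` P))
    (m : nat) (m_order : class_order D P m)
    (beta : K) (beta_in : D beta) (beta_gen : idpow D P m = gen1 D beta)
    (Q : set K) (Q_basic : basic_ideal O F Q)
    (Q_no_basic : forall t, Q t -> ~ basic_elt O F t),
  [/\ (* (i) and (ii) *)
      located O f beta Q \/ located O f (conj beta) Q,
      (* (iii) *)
      forall Q' : set K, basic_ideal O F Q' -> Q' `<=` Q -> Q' = Q
    & (* (iv) *)
      invertible_ideal O Q].
Proof.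
move=> D O F P P_prime Pbar_prime P_neq f_split m [m_gt0 _ _] beta beta_in beta_gen.
move=> Q Q_basic Q_no_basic.
have natK n : (n%:R == 0 :> K) = (n == 0)%N.
  by rewrite -[n%:R]scaler_nat scaler_eq0 oner_eq0 orbF pnatr_eq0.
have f0 : f%:R != 0 :> K by rewrite natK -lt0n prime_gt0.
have K2 : 2 != 0 :> K by rewrite natK.
have [tr [nm [omE conj_om]]] := omega_quadratic K2 sqrtdE conj_sqrtd.
have conjKD := conjK omE conj_om; have conjD := D_conj omE conj_om.
have [idealP _ Pmul] := P_prime; have [PD [P0 PA PM]] := idealP.
have Pf : P f%:R.
  have : idmul P (conj @` P) f%:R.
    by rewrite -f_split; exists 1; [exact: (D1 omE)|rewrite mulr1].
  apply: idmul_min => // x _ Px [y Py <-]; rewrite mulrC.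
  by apply: PM => //; apply/conjD/PD.
have PbarP x : D x -> (conj @` P) x <-> P (conj x).
  move=> Dx; split=> [[y Py <-]|Px]; first by rewrite conjKD //; apply: PD.
  by exists (conj x); rewrite ?conjKD.
have bP : idpow D P m beta.
  by rewrite beta_gen; exists 1; [exact: (D1 omE)|rewrite mulr1].
have P_beta : P beta by move: bP; rewrite -(prednK m_gt0); apply: idpow_sub.
(* the powers x^m with x in P are in P^m = beta D *)
have beta_dvd_exp x : P x -> exists2 z, D z & beta * z = x ^+ m.
  move=> Px; have : idpow D P m (x ^+ m) by apply: idpow_exp; [exact: (D1 omE)|].
  by rewrite beta_gen => -[z Dz ->]; exists z.
have nP_conj_beta : ~ P (conj beta).
  (* otherwise conj x, whose m-th power is a multiple of conj beta, would be in P
     for all x in P, and P would be equal to conj P *)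
  move=> Pcb; have P_conj x : P x -> P (conj x).
    move=> Px; have Dcx := conjD _ (PD _ Px).
    have [z Dz zE] := beta_dvd_exp _ Px.
    apply: contrapT => nPcx.
    apply: (nP_exp omE P_prime (n := m) Dcx nPcx).
    by rewrite -rmorphXn -zE rmorphM mulrC; apply: PM => //; apply: conjD.
  apply: P_neq; apply/seteqP; split=> x Px.
    by apply/PbarP; [exact: PD|exact: P_conj].
  have Dx : D x by case: Pbar_prime => [[sub _] _ _]; apply: sub.
  by rewrite -(conjKD x Dx); apply: P_conj; apply/PbarP.
have beta_dvd : exists n z, D z /\ beta * z = f%:R ^+ n.
  by have [z Dz zE] := beta_dvd_exp _ Pf; exists m, z.
have [I IQ [_ _ ID _ [x Ix nfx]]] := basic_ideal_scale omE conj_om f_prime f0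
  P_prime Pf beta_in P_beta nP_conj_beta Q_basic.
have Dx := ID _ Ix; have Qfx : Q (f%:R * x) by apply/IQ.
(* x is not in both P and conj P; whichever omits x plays the part of conj P *)
have [Pcx|nPcx] := pselect (P (conj x)); last first.
  have [|loc min inv] := located_minimal_invertible omE conj_om f_prime f0
    P_prime Pf beta_in P_beta nP_conj_beta beta_dvd Q_basic Q_no_basic.
    by exists x.
  by split=> //; left.
have nPx : ~ P x.
  by move=> Px; apply: nfx; exact: (P_Pbar_sub omE conj_om f_prime P_prime Pf beta_in
    P_beta nP_conj_beta Px Pcx).
have Dcb := conjD _ beta_in.
have [|||||loc min inv] := located_minimal_invertible omE conj_om f_prime f0
  Pbar_prime _ Dcb _ _ _ Q_basic Q_no_basic.
- by apply/PbarP; [exact: PD|rewrite rmorph_nat].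
- by apply/PbarP; rewrite ?conjKD.
- by rewrite conjKD // => /(PbarP _ beta_in).
- have [n [z [Dz zE]]] := beta_dvd; exists n, (conj z); split; first exact: conjD.
  by rewrite -rmorphM zE rmorphXn rmorph_nat.
- by exists x => // /(PbarP _ (conjD _ Dx)); rewrite conjKD.
by split=> //; right.
Qed.
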